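(* The algorithm Greedy-with-Certificate with parameters $\gamma=0.84$ and $\eta=0.1$ is $0.51$-addition-robust and runs in polynomial time.
   Context: Addition robustness: let $V=V_{\mathsf{now}}\cup V_{\mathsf{future}}$ (disjoint), $f:2^V\to\mathbb{R}_{\ge0}$ non-negative monotone submodular, cardinality constraint $\kappa$. An algorithm that sees only $V_{\mathsf{now}}$ (and $f$ on its subsets, via a value oracle with unit-time queries) and outputs a (possibly random) set $\mathcal{A}[V_{\mathsf{now}}]\subseteq V_{\mathsf{now}}$ with $|\mathcal{A}[V_{\mathsf{now}}]|\le\kappa$ is $\alpha$-addition-robust if for every such instance and every $R\subseteq V_{\mathsf{future}}$: $\mathbb{E}[f(\mathcal{A}[V_{\mathsf{now}}]\cup R)]\ge\alpha\max_{S^*\subseteq V_{\mathsf{now}}\cup R,|S^*|\le\kappa}f(S^* )$. Greedy-with-Certificate with parameters $\eta$ (subsampling limit) and $\gamma$ (threshold), run on $V_{\mathsf{now}}$: (1) let $S$ be the output of the standard greedy algorithm with cardinality $\kappa$ on $V_{\mathsf{now}}$ (repeatedly add an element of maximum marginal value $f(e\mid\cdot)$, $\kappa$ times); (2) set $A^+\gets S$; for $t=1,\dots,\eta\kappa$: if there is $x\in V_{\mathsf{now}}$ with $f(x\mid A^+)\ge\gamma f(S)/\kappa$, add such an $x$ to $A^+$, otherwise stop the loop; (3) return a uniformly random subset $A$ of $A^+$ of cardinality $\kappa$. *)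

(* Defs.v *)
From HB Require Import structures.
From mathcomp Require Import all_boot all_order all_algebra.
From mathcomp Require Import reals.

Set Implicit Arguments.
Unset Strict Implicit.
Unset Printing Implicit Defensive.

Import Order.TTheory GRing.Theory Num.Theory.

Local Open Scope ring_scope.

Definition nonnegative (R : realType) (V : finType) (f : {set V} -> R) : Prop :=
  forall A : {set V}, 0 <= f A.

Definition monotone (R : realType) (V : finType) (f : {set V} -> R) : Prop :=
  forall A B : {set V}, A \subset B -> f A <= f B.

Definition submodular (R : realType) (V : finType) (f : {set V} -> R) : Prop :=
  forall A B : {set V}, f (A :|: B) + f (A :&: B) <= f A + f B.

(* The base value f set0 of the maximum is itself one of the values f S. *)
Definition opt (R : realType) (V : finType) (f : {set V} -> R) (kappa : nat)
    (W : {set V}) : R :=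
  \big[Num.max/f set0]_(S : {set V} | (S \subset W) && (#|S| <= kappa)%N) f S.

(* [comp R N X] is the type of randomized computations over the ground
   set [N] with result in [X].  The oracle is not part of the computation: it is reached
   only through [Query], so a computation depends on the set function only
   through the answers to its queries.  The elementary operations are
   - [Tick]: one step of real or integer arithmetic, one comparison, one
     membership test, or one insertion into a set or list; cost 1;
   - [Query]: one value query; cost 1;
   - [Sample A m]: a uniformly random subset of [A] of cardinality [m] (all
     of [A] if it has fewer than [m] elements); cost #|A| + 1. *)

Inductive comp (R : realType) (N : finType) (X : Type) : Type :=
| Ret of X
| Tick of comp R N X
| Query of {set N} & (R -> comp R N X)
| Sample of {set N} & nat & ({set N} -> comp R N X).

Arguments Ret {R N X} _.
Arguments Tick {R N X} _.
Arguments Query {R N X} _ _.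
Arguments Sample {R N X} _ _ _.

Fixpoint bind (R : realType) (N : finType) (X Y : Type)
    (c : comp R N X) (k : X -> comp R N Y) : comp R N Y :=
  match c with
  | Ret x => k x
  | Tick c' => Tick (bind c' k)
  | Query A h => Query A (fun v => bind (h v) k)
  | Sample A m h => Sample A m (fun B => bind (h B) k)
  end.

Notation "x <- c ;; k" := (bind c (fun x => k))
  (at level 100, c at next level, right associativity).

Definition step (R : realType) (N : finType) (X : Type) (x : X) : comp R N X :=
  Tick (Ret x).

Definition query (R : realType) (N : finType) (A : {set N}) : comp R N R :=
  Query A (fun v => Ret v).

Definition sample (R : realType) (N : finType) (A : {set N}) (m : nat)
    : comp R N {set N} :=
  Sample A m (fun B => Ret B).

Definition subsets_of_card (N : finType) (A : {set N}) (m : nat)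
    : {set {set N}} :=
  [set B : {set N} | (B \subset A) && (#|B| == minn m #|A|)].

Fixpoint expectation (R : realType) (N : finType) (X : Type)
    (g : {set N} -> R) (c : comp R N X) (phi : X -> R) : R :=
  match c with
  | Ret x => phi x
  | Tick c' => expectation g c' phi
  | Query A h => expectation g (h (g A)) phi
  | Sample A m h =>
      (\sum_(B in subsets_of_card A m) expectation g (h B) phi)
        / #|subsets_of_card A m|%:R
  end.

(* [P] holds for every outcome of positive probability. *)
Fixpoint always (R : realType) (N : finType) (X : Type)
    (g : {set N} -> R) (c : comp R N X) (P : X -> Prop) : Prop :=
  match c with
  | Ret x => P x
  | Tick c' => always g c' P
  | Query A h => always g (h (g A)) P
  | Sample A m h =>
      forall B : {set N}, B \in subsets_of_card A m -> always g (h B) P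
  end.

(* Worst case over the random draws. *)
Fixpoint running_time (R : realType) (N : finType) (X : Type)
    (g : {set N} -> R) (c : comp R N X) : nat :=
  match c with
  | Ret _ => 0%N
  | Tick c' => (running_time g c').+1
  | Query A h => (running_time g (h (g A))).+1
  | Sample A m h =>
      (#|A|.+1 + \max_(B in subsets_of_card A m) running_time g (h B))%N
  end.

(* The type [N] is V_now, so an algorithm can neither name an element of
   V_future nor query a set that contains one; the natural number is the
   cardinality constraint. *)
Definition algorithm (R : realType) : Type :=
  forall N : finType, nat -> comp R N {set N}.

Definition to_ground (V : finType) (Vnow : {set V})
    (A : {set {x : V | x \in Vnow}}) : {set V} :=
  [set val x | x in A].

Definition addition_robust (R : realType) (alpha : R) (alg : algorithm R)
    : Prop :=
  forall (V : finType) (Vnow Vfuture : {set V}) (f : {set V} -> R)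
         (kappa : nat),
    Vnow :|: Vfuture = [set: V] -> [disjoint Vnow & Vfuture] ->
    nonnegative f -> monotone f -> submodular f ->
    let g := fun A : {set {x : V | x \in Vnow}} => f (to_ground A) in
    let run := alg {x : V | x \in Vnow} kappa in
    always g run (fun A => (#|to_ground A| <= kappa)%N) /\
    forall Rnew : {set V}, Rnew \subset Vfuture ->
      expectation g run (fun A => f (to_ground A :|: Rnew))
        >= alpha * opt f kappa (Vnow :|: Rnew).

Definition polynomial_time (R : realType) (alg : algorithm R) : Prop :=
  exists p : {poly nat},
    forall (N : finType) (g : {set N} -> R) (kappa : nat),
      nonnegative g -> monotone g -> submodular g ->
      (running_time g (alg N kappa) <= p.[(#|N| + kappa)%N])%N.

(* [tb N t A c C] chooses one of the equally admissible elements of [c :: C]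
   in round [t], when the set built so far is [A].  Because of the round
   number, every sequence of choices in a run comes from some rule. *)
Definition tie_breaking : Type :=
  forall N : finType, nat -> {set N} -> N -> seq N -> N.

Definition tie_breaking_valid (tb : tie_breaking) : Prop :=
  forall (N : finType) (t : nat) (A : {set N}) (c : N) (C : seq N),
    tb N t A c C \in c :: C.

Fixpoint remaining (R : realType) (N : finType) (A : {set N}) (s : seq N)
    : comp R N (seq N) :=
  if s is x :: s' then
    b <- step R N (x \in A) ;;
    r <- remaining R A s' ;;
    step R N (if b then r else x :: r)
  else Ret [::].

(* The pairs (x, f(x | A)) for x in [s]. *)
Fixpoint marginals (R : realType) (N : finType) (A : {set N}) (s : seq N)
    : comp R N (seq (N * R)) :=
  if s is x :: s' then
    Ax <- step R N (x |: A) ;;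
    u <- query R Ax ;;
    v <- query R A ;;
    d <- step R N (u - v) ;;
    r <- marginals R A s' ;;
    step R N ((x, d) :: r)
  else Ret [::].

Fixpoint maximum (R : realType) (N : finType) (m : R) (l : seq (N * R))
    : comp R N R :=
  if l is p :: l' then
    m' <- step R N (Num.max m p.2) ;;
    maximum m' l'
  else Ret m.

Fixpoint at_least (R : realType) (N : finType) (m : R) (l : seq (N * R))
    : comp R N (seq N) :=
  if l is p :: l' then
    b <- step R N (m <= p.2) ;;
    r <- at_least m l' ;;
    step R N (if b then p.1 :: r else r)
  else Ret [::].

(* Elements outside [A] of maximum marginal value; there are none only if [A]
   is the whole ground set. *)
Definition greedy_candidates (R : realType) (N : finType) (A : {set N})
    : comp R N (seq N) :=
  s <- remaining R A (enum N) ;;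
  l <- marginals R A s ;;
  if l is p :: l' then
    m <- maximum p.2 l' ;;
    at_least m l
  else Ret [::].

(* An element of [A] has marginal value 0, so it is a candidate only if
   [theta <= 0]; adding it leaves [A] unchanged. *)
Definition threshold_candidates (R : realType) (N : finType) (theta : R)
    (A : {set N}) : comp R N (seq N) :=
  l <- marginals R A (enum N) ;;
  at_least theta l.

(* At most [k] rounds, numbered from [t], each adding one candidate to [A];
   stop as soon as there is no candidate. *)
Fixpoint grow (R : realType) (N : finType) (tb : tie_breaking)
    (cand : {set N} -> comp R N (seq N)) (k t : nat) (A : {set N})
    : comp R N {set N} :=
  if k is k'.+1 then
    C <- cand A ;;
    if C is c :: C' then
      x <- step R N (tb N t A c C') ;;
      A' <- step R N (x |: A) ;;
      grow tb cand k' t.+1 A'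
    else Ret A
  else Ret A.

(* The loop t = 1, ..., eta * kappa has floor (eta * kappa) rounds. *)
Definition greedy_with_certificate (R : realType) (tb : tie_breaking)
    (eta gamma : R) : algorithm R :=
  fun (N : finType) (kappa : nat) =>
    S <- grow tb (@greedy_candidates R N) kappa 0 set0 ;;
    v <- query R S ;;
    w <- step R N (gamma * v) ;;
    theta <- step R N (w / kappa%:R) ;;
    y <- step R N (eta * kappa%:R) ;;
    k <- step R N (Num.truncn y) ;;
    Aplus <- grow tb (threshold_candidates theta) k kappa S ;;
    sample R Aplus kappa.

(* Main.v *)
Require Import Defs.
From HB Require Import structures.
From mathcomp Require Import all_boot all_order all_algebra.
From mathcomp Require Import reals.
From mathcomp Require Import ring lra zify.

(* Let [s] be the greedy value, [d] kappa times the last greedy gain, [P] the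
   value of an optimal set, [O] its part in V_now and [F] the value of [O], [T]
   and [r] the values of A^+ and of the empty set together with the new
   elements, and [e * kappa] the number of elements added after greedy.
   Submodularity puts the expected value of the sample above
   (T + e r) / (1 + e), and T >= (1 + gamma e) s.
   If the loop stops early, every marginal at A^+ is below gamma s / kappa, so
   T >= P - gamma s, which suffices.  Otherwise the marginals are only bounded
   by d / kappa <= s / kappa; but then a large [d] makes the greedy gains flat,
   so that a short greedy prefix already shows that [F] is small, whence
   r >= P - F is large.  Rounding eta * kappa down costs at most what is won
   from |O| <= kappa - 1, i.e. T >= P - (1 - 1/kappa) d; if |O| = kappa, the
   optimum lies in V_now and the greedy bound applies to it directly. *)

Set Implicit Arguments.
Unset Strict Implicit.
Unset Printing Implicit Defensive.

Import Order.TTheory GRing.Theory Num.Theory.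

Local Open Scope ring_scope.

(** * Deterministic computations *)

(** There is no constructor for [Sample]: all work before the final draw is deterministic, so result
    and cost are single values, and [expectation], [always] and [running_time] can all be pushed
    through [bind] along this one relation. *)
Inductive yields (R : realType) (N : finType) (g : {set N} -> R) (X : Type) :
    Defs.comp R N X -> X -> nat -> Prop :=
| yields_ret x : yields g (Ret x) x 0
| yields_tick c x t : yields g c x t -> yields g (Tick c) x t.+1
| yields_query A h x t : yields g (h (g A)) x t -> yields g (Query A h) x t.+1.

Section Semantics.

Variables (R : realType) (N : finType) (g : {set N} -> R).

Lemma yields_step (X : Type) (x : X) : yields g (step R N x) x 1.
Proof. by do 2!constructor. Qed.

Lemma yields_oracle (A : {set N}) : yields g (query R A) (g A) 1.
Proof. by do 2!constructor. Qed.

Lemma yields_bind (X Y : Type) (c : Defs.comp R N X)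
    (k : X -> Defs.comp R N Y) x t y t' :
  yields g c x t -> yields g (k x) y t' -> yields g (bind c k) y (t + t').
Proof.
by elim=> [//|c' {}x {}t _ IH /IH|A h {}x {}t _ IH /IH] => ?; constructor.
Qed.

Lemma expectation_bind (X Y : Type) (c : Defs.comp R N X)
    (k : X -> Defs.comp R N Y) x t phi :
  yields g c x t -> expectation g (bind c k) phi = expectation g (k x) phi.
Proof. by elim. Qed.

Lemma always_bind (X Y : Type) (c : Defs.comp R N X)
    (k : X -> Defs.comp R N Y) x t P :
  yields g c x t -> always g (k x) P -> always g (bind c k) P.
Proof. by elim. Qed.

Lemma running_time_bind (X Y : Type) (c : Defs.comp R N X)
    (k : X -> Defs.comp R N Y) x t :
  yields g c x t ->
  running_time g (bind c k) = (t + running_time g (k x))%N.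
Proof.
by elim=> [//|c' {}x {}t _ IH|A h {}x {}t _ IH] /=; rewrite IH.
Qed.

Definition marginal (A : {set N}) (x : N) : R := g (x |: A) - g A.

Lemma remaining_yields A s :
  yields g (remaining R A s) [seq x <- s | x \notin A] (2 * size s).
Proof.
elim: s => [|x s IH]; first exact: yields_ret.
have -> : (2 * size (x :: s) = 1 + (2 * size s + 1))%N by rewrite /=; lia.
apply: yields_bind (yields_step _) _; apply: yields_bind IH _.
by rewrite /=; case: (x \in A); apply: yields_step.
Qed.

Lemma marginals_yields A s :
  yields g (marginals R A s) [seq (x, marginal A x) | x <- s] (5 * size s).
Proof.
elim: s => [|x s IH]; first exact: yields_ret.
have -> : (5 * size (x :: s) = 1 + (1 + (1 + (1 + (5 * size s + 1)))))%N.
  by rewrite /=; lia.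
apply: yields_bind (yields_step _) _; apply: yields_bind (yields_oracle _) _.
apply: yields_bind (yields_oracle _) _; apply: yields_bind (yields_step _) _.
by apply: yields_bind IH _; apply: yields_step.
Qed.

Lemma maximum_yields m (l : seq (N * R)) :
  exists M, [/\ yields g (maximum m l) M (size l), m <= M,
    forall p, p \in l -> p.2 <= M & M = m \/ exists2 p, p \in l & M = p.2].
Proof.
elim: l m => [|p l IH] m.
  by exists m; split=> //; [apply: yields_ret | left].
have [M [HM mM lM eM]] := IH (Num.max m p.2).
exists M; split.
- by rewrite /= -add1n; apply: yields_bind (yields_step _) HM.
- by apply: le_trans mM; rewrite le_max lexx.
- move=> q; rewrite inE => /orP [/eqP->|/lM //].
  by apply: le_trans mM; rewrite le_max lexx orbT.
case: eM => [->|[q ql ->]].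
  case: (leP m p.2) => _; last by left.
  by right; exists p => //; rewrite mem_head.
by right; exists q => //; rewrite inE ql orbT.
Qed.

Lemma at_least_yields m (l : seq (N * R)) :
  yields g (at_least m l) [seq p.1 | p <- l & m <= p.2] (2 * size l).
Proof.
elim: l => [|p l IH]; first exact: yields_ret.
have -> : (2 * size (p :: l) = 1 + (2 * size l + 1))%N by rewrite /=; lia.
apply: yields_bind (yields_step _) _; apply: yields_bind IH _.
by rewrite /=; case: (m <= p.2); apply: yields_step.
Qed.

Definition greedy_choice (A : {set N}) (x : N) : Prop :=
  x \notin A /\ forall y, y \notin A -> marginal A y <= marginal A x.

Lemma greedy_candidates_yields (A : {set N}) :
  exists C t, [/\ yields g (@greedy_candidates R N A) C t,
    (t <= 10 * #|N|)%N, forall x, x \in C -> greedy_choice A x &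
    C = [::] -> A = setT].
Proof.
set s := [seq x <- enum N | x \notin A].
have mem_s x : (x \in s) = (x \notin A) by rewrite mem_filter mem_enum andbT.
have size_s : (size s <= #|N|)%N by rewrite cardE size_filter count_size.
have size_e : size (enum N) = #|N| by rewrite -cardE.
pose f x := (x, marginal A x).
case Es : s => [|x0 s'].
  exists [::], (2 * #|N| + (0 + 0))%N; split=> //; first last.
  - move=> _; apply/setP => x; rewrite inE; apply/negbNE.
    by rewrite -mem_s Es.
  - lia.
  rewrite -size_e; apply: yields_bind (remaining_yields _ _) _.
  rewrite -/s Es; apply: yields_bind (marginals_yields A [::]) _.
  exact: yields_ret.
have [M [HM leM geM eM]] := maximum_yields (f x0).2 [seq f x | x <- s'].
have Mub y : y \notin A -> marginal A y <= M.
  rewrite -mem_s Es inE => /orP [/eqP->//|ys'].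
  by apply: (geM (f y)); apply: map_f.
have Matt : exists2 y, y \in s & M = marginal A y.
  case: eM => [->|[p /mapP [y ys' ->] ->]].
    by exists x0 => //; rewrite Es mem_head.
  by exists y => //; rewrite Es inE ys' orbT.
pose C := [seq p.1 | p <- [seq f x | x <- s] & M <= p.2].
exists C, (2 * #|N| + (5 * size s + (size s' + 2 * size s)))%N; split.
- rewrite -size_e; apply: yields_bind (remaining_yields _ _) _.
  rewrite -/s; apply: yields_bind (marginals_yields A s) _.
  rewrite /C Es -[size s'](size_map f) -(size_map f (x0 :: s')).
  apply: (yields_bind HM); exact: at_least_yields.
- by have : (size s' <= size s)%N; [rewrite Es | lia].
- move=> x /mapP [p]; rewrite mem_filter => /andP [Mp /mapP [y ys Ep]] ->.
  move: Mp; rewrite Ep /= => My; split=> [|z zA]; first by rewrite -mem_s.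
  exact: le_trans (Mub z zA) My.
(* The maximum is attained by some [y] in [s], and [y] passes the test against it. *)
move=> C0; have [y ys My] := Matt.
have : y \in C.
  by apply/mapP; exists (f y) => //; rewrite mem_filter map_f // andbT My /=.
by rewrite C0.
Qed.

Lemma threshold_candidates_yields theta (A : {set N}) :
  exists C t, [/\ yields g (threshold_candidates theta A) C t,
    (t <= 7 * #|N|)%N, forall x, x \in C -> theta <= marginal A x &
    C = [::] -> forall x, marginal A x < theta].
Proof.
set l := [seq (x, marginal A x) | x <- enum N].
have size_e : size (enum N) = #|N| by rewrite -cardE.
exists [seq p.1 | p <- l & theta <= p.2].
exists (5 * size (enum N) + 2 * size l)%N; split.
- by apply: yields_bind (marginals_yields _ _) _; apply: at_least_yields.
- by rewrite (size_map _ (enum N)) size_e; lia.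
- move=> x /mapP [p]; rewrite mem_filter => /andP [? /mapP [y _ Ep]] ->.
  by subst.
move=> C0 x; rewrite ltNge; apply/negP => tx.
suff : x \in [::] by [].
rewrite -C0; apply/mapP; exists (x, marginal A x) => //.
rewrite mem_filter tx; apply: (map_f (fun x => (x, marginal A x))).
by rewrite mem_enum.
Qed.

(** The trace of a run of [grow], freed of costs and ties; values of [a] beyond [j] are
    arbitrary. *)
Definition growth (ok : {set N} -> N -> Prop) (a : nat -> {set N}) (j : nat) :=
  forall i, (i < j)%N -> exists2 x, ok (a i) x & a i.+1 = x |: a i.

Lemma grow_yields tb cand (ok : {set N} -> N -> Prop)
    (stop : {set N} -> Prop) c :
  tie_breaking_valid tb ->
  (forall A, exists C t, [/\ yields g (cand A) C t, (t <= c)%N,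
     forall x, x \in C -> ok A x & C = [::] -> stop A]) ->
  forall k t A, exists a j T,
    [/\ yields g (grow tb cand k t A) (a j) T, (T <= k * (c + 2))%N,
        a 0%N = A /\ growth ok a j, (j <= k)%N & j = k \/ stop (a j)].
Proof.
move=> htb hcand; elim=> [|k IH] t A.
  by exists (fun=> A), 0%N, 0%N; split=> //; [apply: yields_ret | left].
have [C [u [HC uc okC stopC]]] := hcand A.
case: C HC okC stopC => [|x0 C] HC okC stopC.
  exists (fun=> A), 0%N, (u + 0)%N; split=> //; last by right; apply: stopC.
    by apply: yields_bind HC _; apply: yields_ret.
  by rewrite mulSn; lia.
set x := tb N t A x0 C.
have [a [j [T [HT Tle [a0 aj] jk stopj]]]] := IH t.+1 (x |: A).
exists (fun i => if i is i'.+1 then a i' else A), j.+1, (u + (1 + (1 + T)))%N.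
split=> //.
- apply: yields_bind HC _; apply: yields_bind (yields_step _) _.
  by apply: yields_bind (yields_step _) HT.
- by rewrite mulSn; lia.
- split=> // -[_|i]; last by rewrite ltnS; apply: aj.
  by exists x; [apply/okC/htb | rewrite a0].
by case: stopj => [->|]; [left | right].
Qed.

End Semantics.

(** * Uniform samples *)

Section Sampling.

Variables (R : realType) (N : finType) (h : {set N} -> R).
Hypothesis subm : submodular h.

(** Submodularity for [X :\ y] and [Y] makes the loss from removing [y] no larger in [X] than in
    [Y]; removing the elements of [Y] one by one, the losses telescope. *)
Lemma sum_removal_le (X Y : {set N}) : Y \subset X ->
  \sum_(x in Y) (h X - h (X :\ x)) <= h Y - h set0.
Proof.
move: {2}#|Y| (erefl #|Y|) => n; elim: n Y => [|n IH] Y cY YX.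
  by rewrite (cards0_eq cY) big_set0 subrr.
have [y yY] : exists y, y \in Y by apply/card_gt0P; rewrite cY.
have cY' : #|Y :\ y| = n by move: cY; rewrite (cardsD1 y) yY => -[].
rewrite (big_setD1 y yY) /=.
have := IH _ cY' (subset_trans (subD1set _ _) YX).
have yX := subsetP YX _ yY.
have := subm (X :\ y) Y.
have -> : (X :\ y) :|: Y = X.
  apply/setP => x; rewrite !inE.
  by case: eqP => [->|_] /=; [rewrite yY yX | apply/orb_idr/(subsetP YX)].
have -> : (X :\ y) :&: Y = Y :\ y.
  apply/setP => x; rewrite !inE -andbA; congr (_ && _).
  exact/andb_idl/(subsetP YX).
lra.
Qed.

(** Double counting: an [m]-subset [B] of [X] survives the removal of [x] for exactly the elements
    [x] of [X :\: B]. *)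
Lemma sum_subsets_removal (X : {set N}) m : (m < #|X|)%N ->
  \sum_(x in X) \sum_(B in subsets_of_card (X :\ x) m) h B =
  (#|X| - m)%:R * \sum_(B in subsets_of_card X m) h B.
Proof.
move=> mX.
rewrite (exchange_big_dep (mem (subsets_of_card X m))) /=; last first.
  move=> x B xX; rewrite !inE => /andP [BX /eqP->].
  rewrite (subset_trans BX (subD1set _ _)) /=.
  have := cardsD1 x X; rewrite xX; lia.
rewrite mulr_sumr; apply: eq_bigr => B; rewrite inE => /andP [BX /eqP cB].
rewrite (eq_bigl (mem (X :\: B))); last first.
  move=> x; rewrite !inE andbC; case xX: (x \in X); rewrite ?andbF //= andbT.
  have := cardsD1 x X; rewrite xX => cX.
  rewrite subsetD1 BX cB /=.
  by case: (x \in B) => //=; apply/eqP; lia.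
rewrite sumr_const cardsD (setIidPr BX) cB mulr_natl; congr (_ *+ _).
by lia.
Qed.

Lemma card_subsets_of_card (X : {set N}) m :
  #|subsets_of_card X m| = 'C(#|X|, minn m #|X|).
Proof. exact: cards_draws. Qed.

(* The average of a submodular function over the m-subsets of X lies above the
   chord joining its values at the empty set and at X. *)
Lemma sum_subsets_ge (X : {set N}) m : (m <= #|X|)%N ->
  'C(#|X|, m)%:R * (m%:R * h X + (#|X| - m)%:R * h set0)
    <= #|X|%:R * \sum_(B in subsets_of_card X m) h B.
Proof.
move: {2}(#|X| - m)%N (erefl (#|X| - m)%N) => d.
elim: d X => [|d IH] X dE mX.
  have -> : m = #|X| by lia.
  rewrite binn subnn mul1r mul0r addr0 (big_pred1 X) // => B.
  rewrite !inE minnn /=; apply/idP/eqP => [/andP [BX /eqP cB]|->].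
    by apply/eqP; rewrite eqEcard BX cB leqnn.
  by rewrite subxx eqxx.
(* The induction step cancels the factor [#|X| - 1], whose positivity comes from [0 < m < #|X|]. *)
case: (posnP m) => [m0|m0].
  rewrite m0 bin0 mul0r add0r mul1r subn0 (big_pred1 set0) // => B.
  rewrite !inE min0n cards_eq0; apply/idP/eqP => [/andP [_ /eqP//]|->].
  by rewrite sub0set eqxx.
have mltX : (m < #|X|)%N by lia.
have HW := sum_subsets_removal mltX.
set W := (X in _ <= _ * X) in HW *.
pose n : R := #|X|%:R.
have nE : #|X|.-1%:R = n - 1 :> R by rewrite -subn1 natrB //; lia.
have cX x : x \in X -> #|X :\ x| = #|X|.-1.
  by move=> xX; rewrite [in RHS](cardsD1 x) xX.
(* The induction hypothesis summed over all sets [X :\ x]. *)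
have IHs : 'C(#|X|.-1, m)%:R *
    (m%:R * \sum_(x in X) h (X :\ x) + n * ((n - 1 - m%:R) * h set0))
    <= (n - 1) * ((n - m%:R) * W).
  rewrite -natrB // -HW mulr_sumr.
  have -> : n * ((n - 1 - m%:R) * h set0)
      = \sum_(x in X) (n - 1 - m%:R) * h set0.
    by rewrite sumr_const mulr_natl.
  rewrite mulr_sumr -big_split mulr_sumr /=.
  apply: ler_sum => x xX; have := IH (X :\ x).
  rewrite !cX // natrB ?nE; last lia.
  by apply; lia.
have HS : (n - 1) * h X + h set0 <= \sum_(x in X) h (X :\ x).
  have := sum_removal_le (subxx X).
  rewrite big_split sumrN /= sumr_const -mulr_natl -/n; lra.
have n1 : 0 < n - 1 by rewrite -nE ltr0n; lia.
have nm : 0 < n - m%:R by rewrite subr_gt0 ltr_nat.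
set C1 : R := 'C(#|X|.-1, m)%:R in IHs.
have C1ge : 0 <= C1 by [].
have HW1 : C1 * (m%:R * h X + (n - m%:R) * h set0) <= (n - m%:R) * W.
  rewrite -(ler_pM2l n1); apply: le_trans IHs.
  rewrite mulrCA ler_wpM2l //.
  have := ler_wpM2l (ler0n R m) HS; lra.
have HC : n * C1 = (n - m%:R) * 'C(#|X|, m)%:R.
  by rewrite -natrB // -!natrM mul_bin_down.
rewrite natrB // -/n -(ler_pM2l nm) mulrA -HC -mulrA.
by rewrite [leRHS]mulrCA ler_wpM2l.
Qed.

End Sampling.

(** * Greedy *)

Section Greedy.

Variables (R : realType) (N : finType) (g : {set N} -> R).
Hypotheses (nonneg : nonnegative g) (mono : monotone g) (subm : submodular g).

Lemma marginal_ge0 A x : 0 <= marginal g A x.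
Proof. by rewrite subr_ge0; apply/mono/subsetUr. Qed.

Lemma marginal_mem (A : {set N}) x : x \in A -> marginal g A x = 0.
Proof. by move=> xA; rewrite /marginal (setUidPr _) ?subrr // sub1set. Qed.

Lemma marginal_anti (A B : {set N}) x : A \subset B ->
  marginal g B x <= marginal g A x.
Proof.
move=> AB; case: (boolP (x \in B)) => [xB|xB].
  by rewrite marginal_mem // marginal_ge0.
have := subm (x |: A) B; rewrite -setUA (setUidPr AB).
have -> : (x |: A) :&: B = A.
  rewrite setIUl (setIidPl AB) (_ : [set x] :&: B = set0) ?set0U //.
  by apply/eqP; rewrite setI_eq0 disjoints1.
rewrite /marginal; lra.
Qed.

Lemma union_le_marginals (A B : {set N}) :
  g (A :|: B) <= g A + \sum_(x in B) marginal g A x.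
Proof.
move: {2}#|B| (erefl #|B|) => n; elim: n B => [|n IH] B cB.
  by rewrite (cards0_eq cB) big_set0 setU0 addr0.
have [y yB] : exists y, y \in B by apply/card_gt0P; rewrite cB.
have cB' : #|B :\ y| = n by move: cB; rewrite (cardsD1 y) yB => -[].
rewrite (big_setD1 y yB) /=; have := IH _ cB'.
have := marginal_anti y (subsetUl A (B :\ y)).
rewrite {1}/marginal setUCA setD1K //; lra.
Qed.

Lemma union_le_bound (A B : {set N}) c :
  (forall x, x \in B -> marginal g A x <= c) ->
  g (A :|: B) <= g A + #|B|%:R * c.
Proof.
move=> Bc; apply: le_trans (union_le_marginals A B) _; rewrite lerD2l.
by rewrite mulr_natl -sumr_const; apply: ler_sum.
Qed.

Variables (a : nat -> {set N}) (kappa : nat).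
Hypotheses (a0 : a 0%N = set0) (agrow : growth (greedy_choice g) a kappa).

Lemma card_growth i : (i <= kappa)%N -> #|a i| = i.
Proof.
elim: i => [|i IH] ik; first by rewrite a0 cards0.
by have [x [xa _] ->] := agrow ik; rewrite cardsU1 xa IH // ltnW.
Qed.

Lemma marginal_le_gain i y : (i < kappa)%N ->
  marginal g (a i) y <= g (a i.+1) - g (a i).
Proof.
move=> /agrow [x [xa xmax] ->]; case: (boolP (y \in a i)) => [ya|/xmax //].
by rewrite marginal_mem // marginal_ge0.
Qed.

(** The element taken second was already on offer one round earlier, with a marginal at least as
    large. *)
Lemma gain_anti i : (i.+1 < kappa)%N ->
  g (a i.+2) - g (a i.+1) <= g (a i.+1) - g (a i).
Proof.
move=> ik; have [x _ Ex] := agrow ik; have [y _ Ey] := agrow (ltnW ik).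
rewrite {1}Ex; apply: le_trans (marginal_le_gain x (ltnW ik)).
by apply: marginal_anti; rewrite Ey subsetUr.
Qed.

Lemma last_gain_le i : (i < kappa)%N ->
  g (a kappa) - g (a kappa.-1) <= g (a i.+1) - g (a i).
Proof.
case: kappa agrow gain_anti => // n _ anti; rewrite ltnS => ik /=.
have -> : n = (i + (n - i))%N by lia.
have : (i + (n - i) <= n)%N by lia.
elim: (n - i)%N => [|m IH]; first by rewrite addn0.
rewrite addnS => im; apply: le_trans (IH _); last lia.
by apply: anti; lia.
Qed.

Lemma marginal_le_last y : (0 < kappa)%N ->
  marginal g (a kappa) y <= g (a kappa) - g (a kappa.-1).
Proof.
move=> k0; have k1 : (kappa.-1 < kappa)%N by rewrite prednK.
have := marginal_le_gain y k1; rewrite prednK //; apply: le_trans.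
apply: marginal_anti; have [x _] := agrow k1.
by rewrite prednK // => ->; apply: subsetUr.
Qed.

(** Each of the [kappa - i] rounds after the prefix gains at least as much as the last round. The
    induction runs backwards from [kappa]. *)
Lemma greedy_prefix_le i : (i <= kappa)%N ->
  g (a i) + (kappa - i)%:R * (g (a kappa) - g (a kappa.-1)) <= g (a kappa).
Proof.
set D := _ - _ => ik; have -> : i = (kappa - (kappa - i))%N by lia.
have : (kappa - i <= kappa)%N by lia.
elim: (kappa - i)%N => [|m IH] mk; first by rewrite !subn0 subnn mul0r addr0.
have /IH H := ltnW mk; have := @last_gain_le (kappa - m.+1)%N.
have -> : ((kappa - m.+1).+1 = kappa - m)%N by lia.
rewrite -/D => /(_ _) HD; have {}HD := HD ltac:(lia).
move: H; rewrite !subKn ?(ltnW mk) // -(natr1 m); lra.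
Qed.

(* A second order expansion of the classical bound 1 - (1 - 1/kappa)^i. *)
Lemma greedy_prefix_ge (O : {set N}) i : (#|O| <= kappa)%N -> (i <= kappa)%N ->
  g O * (i%:R / kappa%:R - i%:R * (i%:R - 1) / 2%:R / kappa%:R ^+ 2)
    <= g (a i).
Proof.
move=> cO; elim: i => [|i IH] ik.
  by rewrite !mul0r subrr mulr0 nonneg.
have k0 : 0 < kappa%:R :> R by rewrite ltr0n; lia.
(* Adding all of [O] to [a i] costs at most [kappa] elements, none better than the greedy choice. *)
have step : g O <= g (a i) + kappa%:R * (g (a i.+1) - g (a i)).
  apply: le_trans (mono (subsetUr (a i) O)) _.
  apply: le_trans (union_le_bound (fun x _ => marginal_le_gain x ik)) _.
  rewrite lerD2l ler_wpM2r ?ler_nat //.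
  by have [x _ ->] := agrow ik; apply: marginal_ge0.
have {}IH := IH (ltnW ik).
pose u : R := kappa%:R^-1.
have u0 : 0 < u by rewrite invr_gt0.
have u1 : u <= 1 by rewrite invf_le1 // ler1n; lia.
have {}step : g O * u <= g (a i) * u + (g (a i.+1) - g (a i)).
  have := ler_wpM2r (ltW u0) step; rewrite mulrDl mulrAC divff ?mul1r //.
  by rewrite gt_eqF.
move: IH; rewrite -!exprVn -/u -(natr1 i).
set n : R := i%:R => IH.
have n0 : 0 <= n * (n - 1).
  rewrite /n; case: (i) => [|m]; first by rewrite mul0r.
  by rewrite -natr1 addrK mulr_ge0 // natr1.
have := ler_wpM2l (_ : 0 <= 1 - u) IH; rewrite subr_ge0 => /(_ u1) IH1.
(* Multiplying out the recursion leaves a cubic term in [u], which is nonnegative and is dropped. *)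
have := mulr_ge0 (nonneg O) (mulr_ge0 n0 (exprn_ge0 3 (ltW u0))).
lra.
Qed.

End Greedy.

(** * The approximation ratio *)

(** The case of an early stop. Eliminating [s] from the two bounds on [T] leaves an inequality in
    [e] alone. *)
Lemma ratio_certificate (R : realFieldType) (e s P T : R) :
  0 <= e <= 1 / 10 -> 0 <= P -> (1 + 84 / 100 * e) * s <= T ->
  P - 84 / 100 * s <= T ->
  51 / 100 * (1 + e) * P <= T.
Proof.
move=> /andP [e0 e10] P0 Ts HT.
pose q := 1 + 84 / 100 * e.
have q0 : 0 < q by rewrite /q; lra.
have H1 : q * P <= T * (q + 84 / 100).
  have := ler_wpM2l (ltW q0) HT; move: Ts; rewrite -/q; nra.
have H2 : 51 / 100 * (1 + e) * (q + 84 / 100) <= q.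
  (* Left minus right is convex in [e], so the ends decide: 0.9384 against 1 at 0, and 1.079364
     against 1.084 at 1/10. *)
  have : 0 <= e * (1 / 10 - e) by rewrite mulr_ge0 ?subr_ge0.
  rewrite /q; lra.
have q1 : 0 < q + 84 / 100 by lra.
rewrite -(ler_pM2r q1); apply: le_trans H1.
by rewrite mulrAC ler_wpM2r.
Qed.

(** The case [#|O| = kappa] with a complete, nonempty loop. The last hypothesis compares with the
    greedy prefix of [3 * j] elements; [s] and [d] are then eliminated. *)
Lemma ratio_now (R : realFieldType) (e s d P T : R) :
  1 / 19 <= e <= 1 / 10 -> 0 <= P -> (1 + 84 / 100 * e) * s <= T ->
  P - d <= T ->
  P * (3 * e - 9 / 2 * e ^+ 2) <= s - (1 - 3 * e) * d ->
  51 / 100 * (1 + e) * P <= T.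
Proof.
move=> /andP [e19 e10] P0 Ts HT Hs.
pose q := 1 + 84 / 100 * e.
have q0 : 0 < q by rewrite /q; lra.
have e3 : 0 <= 1 - 3 * e by lra.
have H1 : q * (1 - 9 / 2 * e ^+ 2) * P <= T * (1 + q * (1 - 3 * e)).
  have A := ler_wpM2l (ltW q0) Hs.
  have B := ler_wpM2l (mulr_ge0 (ltW q0) e3) HT.
  move: Ts; rewrite -/q; lra.
have H2 : 51 / 100 * (1 + e) * (1 + q * (1 - 3 * e))
    <= q * (1 - 9 / 2 * e ^+ 2).
  by rewrite /q; nra.
have q1 : 0 < 1 + q * (1 - 3 * e) by rewrite ltr_wpDr // mulr_ge0 // ltW.
rewrite -(ler_pM2r q1); apply: le_trans H1.
by rewrite mulrAC ler_wpM2r.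
Qed.

(* The lower bounds on T are weighted by a and 1 - a, with a chosen such that
   the coefficient of P becomes exactly 51/100 * (1 + e). *)
Lemma ratio_full (R : realFieldType) (e s d P T u F r : R) :
  1 / 19 <= e <= 1 / 10 -> (1 + 84 / 100 * e) * s <= T ->
  0 <= d <= s -> 0 <= u -> 1 / 10 - 9 / 10 * u <= e ->
  P - (1 - u) * d <= T -> P - F <= r ->
  F * (2 * e - 2 * e ^+ 2) <= s - (1 - 2 * e) * d ->
  51 / 100 * (1 + e) * P <= T + e * r.
Proof.
move=> /andP [e19 e10] Ts /andP [d0 ds] u0 ue HT Hr HF.
(* [w * e] is the coefficient of [F] in the prefix bound, so scaling by [w] cancels [F]; [a + e] is
   the target coefficient of [P]. *)
pose a := 51 / 100 - 49 / 100 * e; pose w := 2 * (1 - e).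
have w0 : 0 < w by rewrite /w; lra.
have a0 : 0 <= a by rewrite /a; lra.
have a1 : 0 <= 1 - a by rewrite /a; lra.
(* What remains is a combination of [s - d] and [d]; [sc] and [sdc] say that its coefficients are
   nonnegative. *)
have sc : 0 <= w * (1 - a) * (1 + 84 / 100 * e) - 1.
  by rewrite /w /a; nra.
have sdc : 0 <= w * (1 - a) * (1 + 84 / 100 * e) - 1
    + (1 - 2 * e - w * a * (1 - u)).
  (* Here the loss from rounding is charged to the gain [u] from [#|O| <= kappa - 1]. *)
  have : (1 - u) <= 1 - (1 / 10 - e) * (10 / 9) by lra.
  move=> /(ler_wpM2l (mulr_ge0 (ltW w0) a0)).
  rewrite /w /a; nra.
have e0 : 0 <= e by lra.
have we : 0 <= w * e by rewrite mulr_ge0 // ltW.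
have A := ler_wpM2l (mulr_ge0 (ltW w0) a0) HT.
have B := ler_wpM2l (mulr_ge0 (ltW w0) a1) Ts.
have C := ler_wpM2l we Hr.
have D : 0 <= (w * (1 - a) * (1 + 84 / 100 * e) - 1) * (s - d).
  by apply: mulr_ge0 => //; rewrite subr_ge0.
have G := mulr_ge0 sdc d0.
rewrite -(ler_pM2l w0); move: A B C D G HF; rewrite /w /a; lra.
Qed.

Definition sample_mean (R : realType) (N : finType) (h : {set N} -> R)
    (X : {set N}) (m : nat) : R :=
  (\sum_(B in subsets_of_card X m) h B) / #|subsets_of_card X m|%:R.

Lemma sample_mean_small (R : realType) (N : finType) (h : {set N} -> R)
    (X : {set N}) m : (#|X| <= m)%N -> sample_mean h X m = h X.
Proof.
move=> Xm; rewrite /sample_mean (_ : subsets_of_card X m = [set X]).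
  by rewrite big_set1 cards1 divr1.
apply/setP => B; rewrite !inE (minn_idPr Xm) eqEcard.
by case: (boolP (B \subset X)) => //= /subset_leq_card; lia.
Qed.

Lemma sample_mean_ge (R : realType) (N : finType) (h : {set N} -> R)
    (X : {set N}) m j :
  monotone h -> submodular h -> (0 < m)%N -> (m <= #|X| <= m + j)%N ->
  m%:R * h X + j%:R * h set0 <= (m%:R + j%:R) * sample_mean h X m.
Proof.
move=> mono subm m0 /andP [mX Xm].
have := sum_subsets_ge subm mX.
rewrite /sample_mean card_subsets_of_card (minn_idPl mX).
set W := \sum_(B in _) _; set C : R := 'C(_, _)%:R; set E := W / C.
have C0 : 0 < C by rewrite ltr0n bin_gt0.
have -> : W = C * E by rewrite mulrC divfK // gt_eqF.
rewrite mulrCA ler_pM2l // natrB //.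
have h0X : h set0 <= h X by apply/mono/sub0set.
set n : R := #|X|%:R; set M : R := m%:R => HE.
have M0 : 0 < M by rewrite ltr0n.
have Mn : M <= n by rewrite ler_nat.
have nj : n <= M + j%:R by rewrite -natrD ler_nat.
have E0 : h set0 <= E.
  rewrite -(ler_pM2l (_ : 0 < n)); last lra.
  have := ler_wpM2l (ltW M0) h0X; lra.
(* [X] may have fewer than [m + j] elements, since a loop with threshold 0 may add an element again;
   the missing weight is made up by the mean exceeding [h set0]. *)
have : 0 <= (M + j%:R - n) * (E - h set0) by rewrite mulr_ge0 // subr_ge0.
lra.
Qed.

Lemma sub_growth (N : finType) ok (b : nat -> {set N}) j :
  growth ok b j -> b 0%N \subset b j.
Proof.
elim: j => [|j IH] bj; first exact: subxx.
have [x _ ->] := bj j (leqnn _).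
by apply: subset_trans (IH _) (subsetUr _ _) => i ij; apply: bj; apply: ltnW.
Qed.

Lemma card_growth_le (N : finType) ok (b : nat -> {set N}) j :
  growth ok b j -> (#|b j| <= #|b 0%N| + j)%N.
Proof.
elim: j => [|j IH] bj; first by rewrite addn0.
have [x _ ->] := bj j (leqnn _).
have := IH (fun i ij => bj i (ltnW ij)); rewrite cardsU1; lia.
Qed.

Lemma threshold_growth_ge (R : realType) (N : finType) (g : {set N} -> R) theta
    (b : nat -> {set N}) j :
  growth (fun A x => theta <= marginal g A x) b j ->
  g (b 0%N) + j%:R * theta <= g (b j).
Proof.
elim: j => [|j IH] bj; first by rewrite mul0r addr0.
have [x + ->] := bj j (leqnn _).
have := IH (fun i ij => bj i (ltnW ij)); rewrite /marginal -(natr1 j); lra.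
Qed.

(** * The ratio for one run and one set of new elements *)

Section Core.

(** [g] is the function seen by the algorithm, and [h] the value after the new elements are joined.
    [P_g] reflects that an optimum with [kappa] elements in V_now has no others. *)
Variables (R : realType) (N : finType) (g h : {set N} -> R).
Hypotheses (g_ge0 : nonnegative g) (g_mono : monotone g)
  (g_subm : submodular g).
Hypotheses (h_mono : monotone h) (h_subm : submodular h).
Hypothesis gh : forall A, g A <= h A.
Hypothesis h_marg : forall A B, h (A :|: B) - h A <= g (A :|: B) - g A.
Variables (kappa : nat) (O : {set N}) (P : R).
Hypotheses (P0 : 0 <= P) (P_h : P <= h O) (cO : (#|O| <= kappa)%N).
Hypothesis P_g : #|O| = kappa -> P <= g O.

(** By [h_marg] the new elements only lower marginals, so a bound on those of [g] limits what [O]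
    can add to [h X]. *)
Lemma opt_le_bound X c : (forall x, marginal g X x <= c) ->
  P <= h X + #|O|%:R * c.
Proof.
move=> Xc; have := union_le_bound g_mono g_subm (B := O) (fun x _ => Xc x).
have := h_marg X O; have := h_mono (subsetUr X O); move: P_h; lra.
Qed.

Lemma opt_le_rest : P <= h set0 + g O.
Proof.
have := h_marg set0 O; rewrite set0U; have := g_ge0 set0; move: P_h; lra.
Qed.

Variables (a b : nat -> {set N}) (j : nat).
Hypotheses (a0 : a 0%N = set0) (agrow : growth (greedy_choice g) a kappa).
Let s := g (a kappa).
Let theta : R := 84 / 100 * s / kappa%:R.
Hypotheses (b0 : b 0%N = a kappa)
  (bgrow : growth (fun A x => theta <= marginal g A x) b j)
  (jle : (j <= kappa %/ 10)%N)
  (bstop : j = (kappa %/ 10)%N \/ forall x, marginal g (b j) x < theta).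

Lemma core_ratio : 51 / 100 * P <= sample_mean h (b j) kappa.
Proof.
have ca : #|a kappa| = kappa by apply: (card_growth a0 agrow).
case: (posnP kappa) => [k0|k0].
  have j0 : j = 0%N by move: jle; rewrite k0; lia.
  have O0 : O = set0 by apply/eqP; rewrite -cards_eq0; lia.
  rewrite sample_mean_small ?j0 ?b0 ?ca // k0 a0 -O0; move: P0 P_h; lra.
set K : R := kappa%:R.
have K0 : 0 < K by rewrite ltr0n.
pose e : R := j%:R / K.
have eK : e * K = j%:R by rewrite divfK // gt_eqF.
have e0 : 0 <= e by rewrite divr_ge0.
have e10 : e <= 1 / 10.
  rewrite ler_pdivrMr //; have : (j * 10 <= kappa)%N by clear -jle; lia.
  rewrite -(ler_nat R) natrM -/K; lra.
have thK : theta * K = 84 / 100 * s by rewrite divfK // gt_eqF.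
set T := h (b j); set E := sample_mean _ _ _; set r := h set0.
have HE : T + e * r <= (1 + e) * E.
  have := @sample_mean_ge _ _ h (b j) kappa j h_mono h_subm k0.
  have -> : (kappa <= #|b j| <= kappa + j)%N.
    have := card_growth_le bgrow; have := subset_leq_card (sub_growth bgrow).
    by rewrite b0 ca => -> ->.
  move=> /(_ isT); rewrite -/K -/T -/E -/r -eK => H.
  rewrite -(ler_pM2l K0); lra.
have r0 : 0 <= r by apply: le_trans (g_ge0 _) (gh _).
have er0 : 0 <= e * r by rewrite mulr_ge0.
have Ts : (1 + 84 / 100 * e) * s <= T.
  apply: le_trans (gh _); have := threshold_growth_ge bgrow; rewrite b0 -/s.
  have -> : j%:R * theta = 84 / 100 * e * s.
    by rewrite -eK mulrAC -mulrA thK; lra.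
  lra.
have e1 : 0 < 1 + e by lra.
suff : 51 / 100 * (1 + e) * P <= T + e * r.
  move=> /le_trans/(_ HE); rewrite -mulrA mulrCA ler_pM2l //.
case: bstop => [jE|stop]; last first.
  have := opt_le_bound (fun x => ltW (stop x)); rewrite -/T => HP.
  have s0 : 0 <= s by apply: g_ge0.
  have th0 : 0 <= theta by rewrite /theta !mulr_ge0 // invr_ge0 ltW.
  have Oth : #|O|%:R * theta <= 84 / 100 * s.
    by rewrite -thK mulrC ler_wpM2l // ler_nat.
  have := @ratio_certificate R e s P T; rewrite e0 e10 => /(_ isT P0 Ts).
  by move=> H; have := H ltac:(lra); lra.
(* From here on the loop ran to its end, and the last greedy gain [D] bounds all marginals at
   [b j]. *)
pose D := s - g (a kappa.-1); pose d := K * D.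
have kk : (kappa.-1 < kappa)%N by rewrite prednK.
have D0 : 0 <= D.
  rewrite subr_ge0 /s; have [x _] := agrow kk; rewrite prednK // => ->.
  exact/g_mono/subsetUr.
have prefix i : (i <= kappa)%N -> g (a i) + (K - i%:R) * D <= s.
  by move=> ik; have := greedy_prefix_le g_mono g_subm agrow ik; rewrite natrB.
have d0 : 0 <= d by rewrite mulr_ge0 // ltW.
have ds : d <= s.
  by have := prefix 0%N isT; have := g_ge0 (a 0%N); rewrite /d; lra.
have HO : P <= T + #|O|%:R * D.
  apply: opt_le_bound => x; have := marginal_le_last g_mono g_subm agrow x k0.
  apply: le_trans; apply: marginal_anti => //.
  by rewrite -b0; apply: sub_growth bgrow.
pose F := g O.
have F0 : 0 <= F := g_ge0 O.
have greedy i : (i <= kappa)%N ->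
    F * (i%:R / K - (i%:R / K) ^+ 2 / 2 + i%:R / K / K / 2) <= g (a i).
  move=> ik; have := greedy_prefix_ge g_ge0 g_mono g_subm agrow cO ik.
  apply: le_trans; apply: ler_wpM2l => //.
  rewrite -/K le_eqVlt; apply/orP; left.
  by apply/eqP; field; rewrite gt_eqF.
(* An empty loop means [kappa <= 9], and greedy alone suffices: its ratio is at least 9/17 if
   [#|O| < kappa], because [P <= T + 8/9 d], and at least 5/9 otherwise. *)
case: (posnP j) => [j0|jpos].
  have k9 : (kappa <= 9)%N by clear -jE j0; lia.
  have K9 : K <= 9 by rewrite (ler_nat R _ 9).
  have eE : e = 0 by rewrite /e j0 mul0r.
  move: Ts; rewrite eE mulr0 addr0 mul1r mul0r addr0 => Ts.
  rewrite mulr1; have [cOk|cOk] := ltnP #|O| kappa.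
    have : #|O|%:R <= K - 1 :> R by rewrite lerBrDr natr1 ler_nat.
    move=> /(ler_wpM2r D0) OD.
    have : (K - 1) * D <= 8 / 9 * (K * D).
      have : 0 <= (9 - K) * D by rewrite mulr_ge0 // subr_ge0.
      lra.
    rewrite -/d; lra.
  have PF : P <= F by apply: P_g; clear -cO cOk; lia.
  have := greedy kappa (leqnn _); rewrite -/K -/s divff ?gt_eqF // => H.
  have : F * (5 / 9) <= F * (1 - 1 ^+ 2 / 2 + 1 / K / 2).
    apply: ler_wpM2l => //.
    have : 1 / 9 <= 1 / K by rewrite !div1r lef_pV2 ?posrE.
    lra.
  lra.
have jr i : (i * j)%:R / K = i%:R * e :> R by rewrite natrM -mulrA.
(* The lower and the upper bound on the greedy prefix of [i * j] elements, which is a fraction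
   [i * e] of the whole. *)
have greedyj i : (i <= 10)%N ->
    F * (i%:R * e - (i%:R * e) ^+ 2 / 2) <= s - (1 - i%:R * e) * d.
  move=> i10; have ik : (i * j <= kappa)%N.
    apply: leq_trans (_ : 10 * (kappa %/ 10) <= _)%N; last by clear; lia.
    exact: leq_mul.
  have := greedy _ ik; have := prefix _ ik; rewrite jr => H1 H2.
  have -> : (1 - i%:R * e) * d = (K - (i * j)%:R) * D.
    by rewrite natrM -eK /d; ring.
  have : 0 <= F * (i%:R * e / K / 2) by rewrite !mulr_ge0 // invr_ge0 ltW.
  lra.
(* [kappa <= 10 * j + 9 <= 19 * j]. *)
have e19 : 1 / 19 <= e.
  rewrite ler_pdivlMr //; have : (kappa <= 19 * j)%N by clear -jE jpos; lia.
  rewrite -(ler_nat R) natrM -/K; lra.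
have [cOk|cOk] := ltnP #|O| kappa.
  apply: (@ratio_full R e s d P T K^-1 F r); rewrite ?e19 ?e10 ?d0 ?ds //.
  - by rewrite invr_ge0 ltW.
  - rewrite -(ler_pM2r K0) eK.
    have -> : (1 / 10 - 9 / 10 * K^-1) * K = K / 10 - 9 / 10.
      by field; rewrite gt_eqF.
    have : (kappa <= 10 * j + 9)%N by clear -jE; lia.
    rewrite -(ler_nat R) natrD natrM -/K; lra.
  - have -> : (1 - K^-1) * d = (K - 1) * D by rewrite /d; field; rewrite gt_eqF.
    have : #|O|%:R <= K - 1 :> R by rewrite lerBrDr natr1 ler_nat.
    move=> /(ler_wpM2r D0); lra.
  - have := opt_le_rest; rewrite -/F -/r; lra.
  by have := @greedyj 2%N isT; lra.
have PF : P <= F by apply: P_g; clear -cO cOk; lia.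
have : 51 / 100 * (1 + e) * P <= T.
  apply: (@ratio_now R e s d P T); rewrite ?e19 ?e10 //.
    have : #|O|%:R * D <= K * D by rewrite ler_wpM2r // ler_nat.
    rewrite -/d; lra.
  have := @greedyj 3%N isT; apply: le_trans.
  have t0 : 0 <= 3 * e - 9 / 2 * e ^+ 2.
    have -> : 3 * e - 9 / 2 * e ^+ 2 = 3 * e * (1 - 3 / 2 * e) by field.
    by apply: mulr_ge0; lra.
  have := ler_wpM2r t0 PF; lra.
lra.
Qed.

End Core.

Lemma truncn_tenth (R : realType) (n : nat) :
  Num.truncn (10%:R / 100%:R * n%:R : R) = (n %/ 10)%N.
Proof.
apply/eqP; rewrite truncn_eq; last by rewrite mulr_ge0 // divr_ge0.
have H : (n %/ 10 * 10 <= n < (n %/ 10).+1 * 10)%N by lia.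
move: H; rewrite -(ler_nat R) -(ltr_nat R) !natrM => /andP [? ?].
by apply/andP; split; lra.
Qed.

(** * Execution of the algorithm: result, distribution and cost *)

Section Run.

Variables (R : realType) (tb : tie_breaking) (N : finType) (g : {set N} -> R).
Hypothesis htb : tie_breaking_valid tb.
Variable kappa : nat.

Let run :=
  greedy_with_certificate tb (10%:R / 100%:R : R) (84%:R / 100%:R) N kappa.

(** Two deterministic chains followed by one draw from [b j]. Greedy falls short of [kappa] rounds
    only by exhausting V_now; the 5 in the cost is one query and four arithmetic steps between the
    phases. *)
Lemma greedy_with_certificate_run : exists a b i j T,
  let theta : R := 84 / 100 * g (a i) / kappa%:R in
  [/\ a 0%N = set0 /\ growth (greedy_choice g) a i,
      (i <= kappa)%N /\ (i = kappa \/ a i = setT),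
      b 0%N = a i /\ growth (fun A x => theta <= marginal g A x) b j,
      (j <= kappa %/ 10)%N /\
      (j = (kappa %/ 10)%N \/ forall x, marginal g (b j) x < theta) &
      [/\ (T <= kappa * (10 * #|N| + 2) + 5 + kappa * (7 * #|N| + 2))%N,
        running_time g run = (T + (#|b j|.+1 + 0))%N,
        forall phi, expectation g run phi = sample_mean phi (b j) kappa &
        forall Q : {set N} -> Prop,
          (forall B, B \in subsets_of_card (b j) kappa -> Q B) ->
          always g run Q]].
Proof.
have [a [i [T1 [HT1 T1le aP ik astop]]]] := grow_yields htb
  (@greedy_candidates_yields R N g) kappa 0 set0.
have [b [j [T2 [HT2 T2le bP jk bstop]]]] := grow_yields htb
  (threshold_candidates_yields g (84 / 100 * g (a i) / kappa%:R)) (kappa %/ 10)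
  kappa (a i).
exists a, b, i, j, (T1 + (1 + (1 + (1 + (1 + (1 + T2))))))%N => /=.
split=> //; split.
- have : (kappa %/ 10 * (7 * #|N| + 2) <= kappa * (7 * #|N| + 2))%N.
    by apply: leq_mul => //; apply: leq_div.
  move=> /(leq_trans T2le); move: T1le; move: (kappa * _)%N (kappa * _)%N.
  clear; lia.
- rewrite /run /greedy_with_certificate (running_time_bind _ HT1) -addnA.
  congr (_ + _)%N; rewrite /= truncn_tenth (running_time_bind _ HT2) /=.
  by rewrite big1 //; lia.
- move=> phi; rewrite /run /greedy_with_certificate.
  rewrite (expectation_bind _ _ HT1) /=.
  by rewrite truncn_tenth (expectation_bind _ _ HT2).
move=> Q HQ; rewrite /run /greedy_with_certificate.
apply: always_bind HT1 _ => /=; rewrite truncn_tenth.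
by apply: always_bind HT2 _.
Qed.

End Run.

(** * Passage from subsets of V_now as a type to subsets of the ground set *)

Section ToGround.

Variables (V : finType) (Vnow : {set V}).
Implicit Types A B : {set {x : V | x \in Vnow}}.

Lemma card_to_ground A : #|to_ground A| = #|A|.
Proof. exact/card_imset/val_inj. Qed.

Lemma to_groundS A B : A \subset B -> to_ground A \subset to_ground B.
Proof. exact: imsetS. Qed.

Lemma to_groundU A B : to_ground (A :|: B) = to_ground A :|: to_ground B.
Proof. exact: imsetU. Qed.

Lemma to_groundI A B : to_ground (A :&: B) = to_ground A :&: to_ground B.
Proof. by apply: imsetI => x y _ _; apply: val_inj. Qed.

Lemma to_ground_preim (O : {set V}) :
  to_ground [set x : {x : V | x \in Vnow} | val x \in O] = O :&: Vnow.
Proof.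
apply/setP => x; rewrite inE; apply/imsetP/andP => [[y]|[xO xV]].
  by rewrite inE => yO ->; split=> //; apply: valP.
by exists (Sub x xV); rewrite ?inE.
Qed.

End ToGround.

Theorem theorem6 (R : realType) (tb : tie_breaking)
    (htb : tie_breaking_valid tb) :
  let eta : R := 10%:R / 100%:R in
  let gamma : R := 84%:R / 100%:R in
  addition_robust (51%:R / 100%:R) (greedy_with_certificate tb eta gamma) /\
  polynomial_time (greedy_with_certificate tb eta gamma).
Proof.
split; last first.
  (* The cost is at most [kappa * (17 * n + 4) + n + 6], with [n] the size of V_now. *)
  exists (17%:R%:P * 'X ^+ 2 + 5%:R%:P * 'X + 6%:R%:P) => N g kappa _ _ _.
  have [a [b [i [j [T [_ _ _ _ [HT -> _ _]]]]]]] :=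
    greedy_with_certificate_run g htb kappa.
  rewrite !hornerE /= !natn.
  have : (#|b j| <= #|N|)%N by apply: max_card.
  move: HT; set n := #|N|; set m := #|b j|; rewrite !natrDE !natrME; nia.
move=> V Vnow Vfuture f kappa _ _ f0 fmono fsubm g run.
have [a [b [i [j [T []]]]]] := greedy_with_certificate_run g htb kappa.
rewrite /= => -[a0 agrow] [ik istop] [b0 bgrow] [jk jstop] [_ _ HE HA].
split.
  apply: HA => B; rewrite inE card_to_ground => /andP [_ /eqP->].
  exact: geq_minl.
move=> Rnew _; rewrite HE.
set h := (X in sample_mean X).
have g0 : nonnegative g by move=> A; apply: f0.
have gmono : monotone g by move=> A B AB; apply/fmono/to_groundS.
have gsubm : submodular g.
  by move=> A B; rewrite /g to_groundU to_groundI.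
have hmono : monotone h by move=> A B AB; apply/fmono/setSU/to_groundS.
have hsubm : submodular h.
  move=> A B; rewrite /h to_groundU to_groundI setUIl setUUl; apply: fsubm.
have gh A : g A <= h A by apply/fmono/subsetUl.
have hmarg A B : h (A :|: B) - h A <= g (A :|: B) - g A.
  have := fsubm (to_ground (A :|: B)) (to_ground A :|: Rnew).
  have -> : to_ground (A :|: B) :|: (to_ground A :|: Rnew)
      = to_ground (A :|: B) :|: Rnew.
    by rewrite setUA; congr (_ :|: _); apply/setUidPl/to_groundS/subsetUl.
  have : f (to_ground A) <= f (to_ground (A :|: B) :&: (to_ground A :|: Rnew)).
    by apply: fmono; rewrite subsetI subsetUl to_groundS // subsetUl.
  rewrite /h /g; lra.
suff HO (O : {set V}) : O \subset Vnow :|: Rnew -> (#|O| <= kappa)%N ->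
    51%:R / 100%:R * f O <= sample_mean h (b j) kappa.
  have c0 : 0 < 51%:R / 100%:R :> R by rewrite divr_gt0.
  rewrite mulrC -ler_pdivlMr //; apply: bigmax_le => [|O /andP [OV cO]].
    (* The base value of the maximum is covered by the empty set. *)
    by rewrite ler_pdivlMr // mulrC HO ?sub0set ?cards0.
  by rewrite ler_pdivlMr // mulrC HO.
move=> OV cO; pose O' := [set x : {x : V | x \in Vnow} | val x \in O].
have O'E : to_ground O' = O :&: Vnow by apply: to_ground_preim.
have cO' : #|O'| = #|O :&: Vnow| by rewrite -O'E card_to_ground.
have PhO : f O <= h O'.
  apply: fmono; rewrite O'E; apply/subsetP => x xO.
  by have := subsetP OV x xO; rewrite !inE xO.
have cO'k : (#|O'| <= kappa)%N.
  by rewrite cO'; apply: leq_trans cO; apply/subset_leq_card/subsetIl.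
have [iE|iE] := eqVneq i kappa.
  subst i; apply: (core_ratio g0 gmono gsubm hmono hsubm gh hmarg (f0 O) PhO
    cO'k _ a0 agrow b0 bgrow jk jstop) => cE.
  (* If [O :&: Vnow] already has [kappa] elements, it is all of [O]. *)
  apply: fmono; rewrite O'E subsetI subxx /=; apply/setIidPl/eqP.
  by rewrite eqEcard subsetIl -cO' cE.
(* Greedy exhausted V_now within [kappa] elements, so the sample is all of V_now and loses
   nothing. *)
have aT : a i = setT by case: istop => // /eqP; rewrite (negbTE iE).
have bT : b j = setT.
  by apply/eqP; rewrite -subTset -aT -b0; apply: sub_growth bgrow.
rewrite sample_mean_small ?bT; last by rewrite -aT (card_growth a0 agrow).
have := hmono _ _ (subsetT O'); have := f0 O; move: PhO; lra.
Qed.
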